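(* Let $r$ be a nonnegative integer, let $k$ be a positive integer, and let $\lambda>0$, $a>0$. Then $$\int_a^{\infty}\frac{dx}{(x+r)(x+r+\lambda)\cdots(x+r+k\lambda)}=\frac{1}{k!\,\lambda^k}\sum_{l=0}^{k}\binom{k}{l}(-1)^{l+1}\log(a+r+l\lambda),$$ and $$\frac{1}{k a^k}=\sum_{n=k}^{\infty}{n+r \brack k+r}_{r,\lambda}\frac{1}{n!\,\lambda^n}\sum_{l=0}^{n}\binom{n}{l}(-1)^{l+1}\log(a+r+l\lambda).$$
   Context: The generalized rising factorial is $\langle x\rangle_{0,\lambda}=1$, $\langle x\rangle_{n,\lambda}=x(x+\lambda)\cdots(x+(n-1)\lambda)$ for $n\ge1$. For a nonnegative integer $r$, the $\lambda$-analogues of unsigned $r$-Stirling numbers of the first kind ${n+r \brack k+r}_{r,\lambda}$ are defined by $\langle x+r\rangle_{n,\lambda}=\sum_{k=0}^n{n+r \brack k+r}_{r,\lambda}x^k$ for $n\ge0$. *)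

(* Defs.v *)
From mathcomp Require Import all_boot all_order all_algebra.
From mathcomp Require Import all_classical all_reals all_analysis.

Set Implicit Arguments.
Unset Strict Implicit.
Unset Printing Implicit Defensive.
Import Order.TTheory GRing.Theory Num.Theory.
Import numFieldNormedType.Exports.
Local Open Scope ring_scope.

(* <x>_{n,lam}; the ring A is arbitrary so that x may also be a polynomial. *)
Definition gen_rising (A : comNzRingType) (lam x : A) (n : nat) : A :=
  \prod_(j < n) (x + j%:R * lam).

(* rstirling1 r lam n k is the bracket [n+r, k+r]_{r,lam}: the arguments are
   n and k, not n + r and k + r.  Its defining identity
   <x + r>_{n,lam} = \sum_(k <= n) [n+r, k+r]_{r,lam} x^k is read as an identity
   of polynomials in x. *)
Definition rstirling1 (A : comNzRingType) (r : nat) (lam : A) (n k : nat) : A :=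
  (gen_rising lam%:P ('X + r%:R) n)`_k.

Lemma gen_rising_rstirling1 (A : comNzRingType) (r : nat) (lam x : A) (n : nat) :
  gen_rising lam (x + r%:R) n = \sum_(k < n.+1) rstirling1 r lam n k * x ^+ k.
Proof.
have -> : gen_rising lam (x + r%:R) n = (gen_rising lam%:P ('X + r%:R) n).[x].
  rewrite /gen_rising horner_prod; apply: eq_bigr => j _.
  by rewrite -!polyC_natr -polyCM !hornerE.
apply: horner_coef_wide; rewrite /gen_rising.
elim: n => [|n IHn]; first by rewrite big_ord0 size_poly1.
rewrite big_ord_recr /=; apply: (leq_trans (size_polyMleq _ _)).
have -> : 'X + r%:R + n%:R * lam%:P = 'X + (r%:R + n%:R * lam)%:P.
  by rewrite -addrA polyCD polyCM !polyC_natr.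
by rewrite size_XaddC addn2.
Qed.

(* Main.v *)
(* Write P_n(x) = <x + r>_{n,lam}.  Partial fractions of 1 / P_{k+1} come from the
   k-th finite difference of 1 / x; the corresponding combination of logarithms is
   a primitive that vanishes at infinity, which gives the first formula.

   For the second, put p_n(j) = [n+r, j+r] x^j / P_n(x).  The recurrence of the
   bracket makes [n+r, k+r] / P_{n+1}(x) telescope in n:
     sum_{n < N} [n+r, k+r] / P_{n+1}(x) = x^{-(k+1)} (1 - sum_{j <= k} p_N(j)).
   Moreover p_N(j) <= 2^j P_N(x/2) / P_N(x), since [N+r, j+r] (x/2)^j is one of the
   nonnegative terms of P_N(x/2), and this ratio tends to 0 by the divergence of
   the harmonic series.  Hence the series sums to x^{-(k+1)}, and integrating
   over [a, +oo) by monotone convergence yields 1 / (k a^k). *)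
Require Import Defs.
From mathcomp Require Import all_boot all_order all_algebra.
From mathcomp Require Import all_classical all_reals all_analysis.
From mathcomp Require Import measurable_realfun ring lra.
Set Implicit Arguments.
Unset Strict Implicit.
Unset Printing Implicit Defensive.
Import Order.TTheory GRing.Theory Num.Theory.
Import numFieldNormedType.Exports.
Local Open Scope classical_set_scope.
Local Open Scope ring_scope.

(** Pascal's rule splits each coefficient; the half coming from ['C(n, l.-1)] is reindexed by one
    and changes sign. Lowering the order this way drives the induction for partial fractions and
    exposes the cancellation of logarithms at infinity. *)
Lemma alternating_binomial_sumS (A : comNzRingType) (f : nat -> A) (n : nat) :
  \sum_(l < n.+2) 'C(n.+1, l)%:R * (-1) ^+ l * f l =
  \sum_(l < n.+1) 'C(n, l)%:R * (-1) ^+ l * (f l - f l.+1).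
Proof.
transitivity (\sum_(l < n.+2) 'C(n, l)%:R * (-1) ^+ l * f l
            - \sum_(l < n.+1) 'C(n, l)%:R * (-1) ^+ l * f l.+1).
  rewrite !(big_ord_recl n.+1) !bin0 -addrA -sumrB; congr (_ + _).
  by apply: eq_bigr => l _; rewrite /= /bump /= add1n binS natrD exprS; ring.
rewrite big_ord_recr /= bin_small // !mul0r addr0 -sumrB.
by apply: eq_bigr => l _; rewrite mulrBr.
Qed.

(** * Recurrences for rising factorials and brackets *)

Section GenRising.
Context {A : comNzRingType}.
Implicit Types (lam x : A) (n : nat).

Lemma gen_rising0 lam x : gen_rising lam x 0 = 1.
Proof. exact: big_ord0. Qed.

Lemma gen_risingS lam x n :
  gen_rising lam x n.+1 = gen_rising lam x n * (x + n%:R * lam).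
Proof. exact: big_ord_recr. Qed.

Lemma gen_risingSl lam x n :
  gen_rising lam x n.+1 = x * gen_rising lam (x + lam) n.
Proof.
rewrite /gen_rising big_ord_recl mul0r addr0; congr (_ * _).
by apply: eq_bigr => j _; rewrite /= /bump add1n mulrSr; ring.
Qed.

End GenRising.

Section RStirling1.
Context {A : comNzRingType}.
Implicit Types (lam : A) (n k r : nat).

Lemma rstirling1_0 r lam k : rstirling1 r lam 0 k = (k == 0)%:R.
Proof. by rewrite /rstirling1 gen_rising0 coef1. Qed.

Lemma rstirling1_rec r lam n k :
  rstirling1 r lam n.+1 k =
  (if k is j.+1 then rstirling1 r lam n j else 0) +
  (r%:R + n%:R * lam) * rstirling1 r lam n k.
Proof.
rewrite /rstirling1 gen_risingS -addrA -!polyC_natr -polyCM -polyCD.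
by rewrite mulrDr coefD coefMC coefMX [_`_k * _]mulrC; case: k.
Qed.

Lemma rstirling1_small r lam n k : (n < k)%N -> rstirling1 r lam n k = 0.
Proof.
elim: n k => [|n IHn] [|k] // nk; first by rewrite rstirling1_0.
by rewrite rstirling1_rec !IHn ?mulr0 ?addr0 // ltnW.
Qed.

End RStirling1.

(** * Growth of ratios of rising factorials *)

Section RisingRatio.
Context {R : realType}.
Implicit Types (lam x y : R) (n k r : nat).

Lemma rstirling1_ge0 r lam n k : 0 <= lam -> 0 <= rstirling1 r lam n k.
Proof.
move=> lam0; elim: n k => [|n IHn] k; first by rewrite rstirling1_0.
rewrite rstirling1_rec addr_ge0 //; first by case: k.
by rewrite mulr_ge0 // addr_ge0 ?mulr_ge0.
Qed.

Lemma gen_rising_gt0 lam x n : 0 <= lam -> 0 < x -> 0 < gen_rising lam x n.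
Proof. by move=> lam0 x0; apply: prodr_gt0 => j _; rewrite ltr_wpDr ?mulr_ge0. Qed.

(** The ratio is a product of factors [1 + u_j] with [u_j = (x - y) / (y + j lam) >= 0], and such a
    product is at least [1] plus the sum of the [u_j]. *)
Lemma le_gen_rising_ratio lam x y n : 0 <= lam -> 0 < y -> y <= x ->
  1 + (x - y) * \sum_(j < n) (y + j%:R * lam)^-1 <=
  gen_rising lam x n / gen_rising lam y n.
Proof.
move=> lam0 y0 yx; have x0 : 0 < x by exact: lt_le_trans yx.
elim: n => [|n IHn]; first by rewrite !gen_rising0 big_ord0 mulr0 addr0 divr1.
have yn0 : 0 < y + n%:R * lam by rewrite ltr_wpDr ?mulr_ge0.
have Py0 := gen_rising_gt0 n lam0 y0.
rewrite !gen_risingS big_ord_recr /= invfM mulrACA.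
have -> : (x + n%:R * lam) / (y + n%:R * lam) = 1 + (x - y) / (y + n%:R * lam).
  by field; rewrite gt_eqF.
rewrite [leRHS]mulrDr mulr1 mulrDr addrA; apply: lerD => //.
apply: ler_peMl; first by rewrite divr_ge0 ?subr_ge0 // ltW.
apply: le_trans IHn; rewrite lerDl mulr_ge0 ?subr_ge0 // sumr_ge0 // => j _.
by rewrite invr_ge0 addr_ge0 ?mulr_ge0 // ltW.
Qed.

Lemma cvgr_gen_rising_ratio lam x y : 0 <= lam -> 0 < y -> y < x ->
  gen_rising lam y n / gen_rising lam x n @[n --> \oo] --> 0.
Proof.
move=> lam0 y0 yx; have x0 : 0 < x by exact: lt_trans yx.
under eq_fun do rewrite -invf_div.
have ratio_gt0 n : 0 < gen_rising lam x n / gen_rising lam y n.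
  by rewrite divr_gt0 ?gen_rising_gt0.
apply/(gtr0_cvgV0 _) => /=; first exact: nearW.
have yl0 : 0 < y + lam by rewrite ltr_wpDr.
have c0 : 0 < (x - y) / (y + lam) by rewrite divr_gt0 ?subr_gt0.
(* The constant comes from [y + j lam <= (j + 1) (y + lam)], which compares each term with a
   harmonic one. *)
apply: (@ger_cvgy _ _ _ _ (fun n : nat => (x - y) / (y + lam) * series harmonic n)).
  apply: nearW => n.
  apply: le_trans (le_gen_rising_ratio n lam0 y0 (ltW yx)).
  rewrite ler_wpDl // -mulrA ler_wpM2l ?subr_ge0 ?(ltW yx) //.
  rewrite /series /= big_mkord mulr_sumr; apply: ler_sum => j _.
  rewrite -invfM lef_pV2 ?posrE ?ltr_wpDr ?mulr_gt0 ?mulr_ge0 //.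
  rewrite -natr1; have : 0 <= j%:R * y by rewrite mulr_ge0 // ltW.
  by move=> jy; nra.
have /cvgryPge harmy : series (@harmonic R) @ \oo --> +oo.
  apply: nondecreasing_dvgn_lt; last exact: dvg_harmonic.
  by apply: nondecreasing_series => n _ _; exact: harmonic_ge0.
apply/cvgryPge => M; apply: filterS (harmy (M / ((x - y) / (y + lam)))) => n /=.
by rewrite ler_pdivrMr // mulrC.
Qed.

End RisingRatio.

(** * Summation of the bracket series at a fixed point *)

Section StirlingSeries.
Context {R : realType}.
Implicit Types (lam x : R) (n k r : nat).

(* With q = x / (x + r + n lam), the weights
   p n j = rstirling1 r lam n j * x ^+ j / gen_rising lam (x + r%:R) n satisfy
   p n.+1 j = q * p n j.-1 + (1 - q) * p n j, so p n j - p n.+1 j telescopes in j. *)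
Lemma rstirling1_telescope r lam x n k : 0 <= lam -> 0 < x ->
  x ^+ k.+1 * (rstirling1 r lam n k / gen_rising lam (x + r%:R) n.+1) =
  \sum_(j < k.+1)
    (rstirling1 r lam n j * x ^+ j / gen_rising lam (x + r%:R) n -
     rstirling1 r lam n.+1 j * x ^+ j / gen_rising lam (x + r%:R) n.+1).
Proof.
move=> lam0 x0; have xr0 : 0 < x + r%:R by rewrite ltr_wpDr.
have Pn0 := gen_rising_gt0 n lam0 xr0.
have xn0 : 0 < x + r%:R + n%:R * lam by rewrite ltr_wpDr ?mulr_ge0.
rewrite gen_risingS; elim: k => [|k IHk].
  rewrite big_ord1 rstirling1_rec /=; field.
  by rewrite !gt_eqF.
rewrite big_ord_recr /= -IHk rstirling1_rec !exprS; field.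
by rewrite !gt_eqF.
Qed.

Lemma rstirling1_partial_sum r lam x k N : 0 <= lam -> 0 < x ->
  \sum_(n < N) rstirling1 r lam n k / gen_rising lam (x + r%:R) n.+1 =
  (x ^+ k.+1)^-1 *
  (1 - \sum_(j < k.+1)
         rstirling1 r lam N j * x ^+ j / gen_rising lam (x + r%:R) N).
Proof.
move=> lam0 x0; apply: (@mulfI _ (x ^+ k.+1)); first by rewrite gt_eqF ?exprn_gt0.
rewrite mulVKf ?gt_eqF ?exprn_gt0 // mulr_sumr.
elim: N => [|N IHN].
  (* At [N = 0] the only nonzero weight is the one at [j = 0], equal to [1], so both sides
     vanish. *)
  rewrite big_ord0 big_ord_recl gen_rising0 rstirling1_0 /= mulr1 divr1.
  rewrite big1 => [|j _]; first by rewrite addr0 subrr.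
  by rewrite rstirling1_0 !mul0r.
by rewrite big_ord_recr /= IHN rstirling1_telescope // sumrB; ring.
Qed.

Lemma rstirling1_weight_le r lam x n j : 0 <= lam -> 0 < x ->
  rstirling1 r lam n j * x ^+ j <= gen_rising lam (x + r%:R) n.
Proof.
move=> lam0 x0; have [nj|jn] := ltnP n j.
  by rewrite rstirling1_small // mul0r ltW // gen_rising_gt0 // ltr_wpDr.
have j1 : (j < n.+1)%N by [].
rewrite gen_rising_rstirling1 (bigD1 (Ordinal j1)) //= lerDl sumr_ge0 // => i _.
by rewrite mulr_ge0 ?rstirling1_ge0 // exprn_ge0 // ltW.
Qed.

(** Any [y] strictly between [0] and [x] would serve as well as [x / 2]: passing from [x ^+ j] to
    [y ^+ j] costs [(x / y) ^+ j], which does not depend on [n]. *)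
Lemma cvgr_rstirling1_weight r lam x j : 0 < lam -> 0 < x ->
  rstirling1 r lam n j * x ^+ j / gen_rising lam (x + r%:R) n @[n --> \oo] --> 0.
Proof.
move=> lam_gt0 x0; have lam0 := ltW lam_gt0.
have x20 : 0 < x / 2 by rewrite divr_gt0.
have G0 n : 0 < gen_rising lam (x + r%:R) n by rewrite gen_rising_gt0 // ltr_wpDr.
have ub : 2 ^+ j * (gen_rising lam (x / 2 + r%:R) n / gen_rising lam (x + r%:R) n)
    @[n --> \oo] --> 0.
  rewrite -(mulr0 (2 ^+ j)); apply: cvgMl_tmp; apply: cvgr_gen_rising_ratio => //.
    by rewrite ltr_wpDr.
  by rewrite ltrD2r; lra.
apply: (squeeze_cvgr _ (cvg_cst 0) ub); apply: nearW => n.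
apply/andP; split.
  by rewrite divr_ge0 ?mulr_ge0 ?rstirling1_ge0 ?exprn_ge0 // ltW.
rewrite mulrA ler_pM2r ?invr_gt0 //.
have -> : x ^+ j = 2 ^+ j * (x / 2) ^+ j by rewrite -exprMn mulrC divfK.
by rewrite mulrCA ler_pM2l ?exprn_gt0 // rstirling1_weight_le.
Qed.

Lemma cvgr_rstirling1_series r lam x k : 0 < lam -> 0 < x ->
  \sum_(n < N) rstirling1 r lam n k / gen_rising lam (x + r%:R) n.+1
    @[N --> \oo] --> (x ^+ k.+1)^-1.
Proof.
move=> lam0 x0.
under eq_fun do rewrite rstirling1_partial_sum ?(ltW lam0) //.
have weights0 : \sum_(j < k.+1)
    rstirling1 r lam N j * x ^+ j / gen_rising lam (x + r%:R) N @[N --> \oo] --> 0.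
  have := @cvg_big R _ +%R 0 predT (@add_continuous R) _ \oo (index_enum 'I_k.+1) _ _ _
    (fun j _ => @cvgr_rstirling1_weight r lam x j lam0 x0).
  by rewrite big1 //; exact.
have := cvgMl_tmp (a := (x ^+ k.+1)^-1) (cvgB (cvg_cst (1 : R)) weights0).
by rewrite subr0 mulr1; exact.
Qed.

End StirlingSeries.

(** * Partial fractions and the logarithmic primitive *)

Section PartialFractions.
Context {R : realType}.
Implicit Types (lam x y : R) (n k : nat).

Lemma gen_rising_partial_fractions lam y k : 0 < lam -> 0 < y ->
  (gen_rising lam y k.+1)^-1 =
  (k`!%:R * lam ^+ k)^-1 *
    \sum_(l < k.+1) 'C(k, l)%:R * (-1) ^+ l * (y + l%:R * lam)^-1.
Proof.
move=> lam0; elim: k y => [|k IHk] y y0.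
  by rewrite big_ord1 gen_risingS gen_rising0 /= mul0r addr0 expr0 !mulr1 !mul1r invr1 mul1r.
have yl0 : 0 < y + lam by rewrite addr_gt0.
have yk0 : 0 < y + k.+1%:R * lam by rewrite addr_gt0 // mulr_gt0.
rewrite (alternating_binomial_sumS (fun l => (y + l%:R * lam)^-1)).
under eq_bigr do rewrite mulrBr.
rewrite sumrB mulrBr factS natrM exprS.
have -> : (k.+1%:R * k`!%:R * (lam * lam ^+ k))^-1 =
    (k.+1%:R * lam)^-1 * (k`!%:R * lam ^+ k)^-1 by rewrite -invfM mulrACA.
rewrite -!mulrA -mulrBr -IHk //.
have -> : \sum_(l < k.+1) 'C(k, l)%:R * (-1) ^+ l / (y + l.+1%:R * lam) =
    \sum_(l < k.+1) 'C(k, l)%:R * (-1) ^+ l / (y + lam + l%:R * lam).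
  by apply: eq_bigr => l _; congr (_ / _); rewrite mulrSr; ring.
(* The three products share the factor [gen_rising lam (y + lam) k]; what remains is
   [1 / y - 1 / (y + (k + 1) lam)] written over a common denominator. *)
rewrite -IHk // gen_risingSl [in X in _ * (X - _)]gen_risingSl gen_risingS.
have G0 := gen_rising_gt0 k (ltW lam0) yl0.
have ylk : y + lam + k%:R * lam = y + k.+1%:R * lam by rewrite mulrSr; ring.
rewrite !ylk; field.
by rewrite nat1r !gt_eqF.
Qed.

(** The partial fraction expansion integrated term by term. For [k > 0] this choice of integration
    constant makes it vanish at infinity. *)
Definition log_gen_rising_primitive lam k y : R :=
  (k`!%:R * lam ^+ k)^-1 *
    \sum_(l < k.+1) 'C(k, l)%:R * (-1) ^+ l * ln (y + l%:R * lam).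

Lemma is_derive_log_primitive lam k y : 0 < lam -> 0 < y ->
  is_derive y 1 (log_gen_rising_primitive lam k) (gen_rising lam y k.+1)^-1.
Proof.
move=> lam0 y0; rewrite gen_rising_partial_fractions //.
rewrite (_ : log_gen_rising_primitive lam k = (k`!%:R * lam ^+ k)^-1 *:
  \sum_(l < k.+1) (('C(k, l)%:R * (-1) ^+ l) *: (@ln R \o (fun z => z + l%:R * lam)) : R -> R));
  last first.
  apply/funext => z; rewrite /log_gen_rising_primitive.
  by rewrite /GRing.scale /= fct_sumE; congr (_ * _).
apply: is_deriveZ; apply: is_derive_sum => l; apply: is_deriveZ.
rewrite -[X in is_derive _ _ _ X]mulr1; apply: is_derive1_comp.
  by apply: is_derive1_ln; rewrite ltr_wpDr // mulr_ge0 // ltW.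
by apply: is_derive_eq; rewrite addr0.
Qed.

(** The difference is [ln (1 + lam / x)], squeezed between [0] and [lam / x]. *)
Lemma cvgr_log_shift lam :
  0 < lam -> ln (x + lam) - ln x @[x --> +oo] --> 0.
Proof.
move=> lam0.
have ub : lam * x^-1 @[x --> +oo] --> 0.
  rewrite -(mulr0 lam); apply: cvgMl_tmp.
  apply/gtr0_cvgV0; first by near=> x; near: x; exact: nbhs_pinfty_gt.
  exact: cvg_id.
apply: (squeeze_cvgr _ (cvg_cst 0) ub); near=> x.
have x0 : 0 < x by near: x; exact: nbhs_pinfty_gt.
have xl0 : 0 < x + lam by rewrite addr_gt0.
rewrite -ln_div ?posrE //.
have -> : (x + lam) / x = 1 + lam * x^-1 by rewrite mulrDl divff // gt_eqF.
have q0 : 0 < lam * x^-1 by rewrite divr_gt0.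
rewrite ln_ge0 ?lerDl ?(ltW q0) //= le_ln1Dx //.
by apply: lt_trans q0; rewrite ltrN10.
Unshelve. all: by end_near. Qed.

(** One finite difference pairs neighbouring logarithms, and each pair tends to [0]. For [k = 0]
    there is nothing to pair: the function is [ln] itself. *)
Lemma cvgr_log_primitive lam k : (0 < k)%N -> 0 < lam ->
  log_gen_rising_primitive lam k x @[x --> +oo] --> 0.
Proof.
case: k => // k _ lam0; rewrite /log_gen_rising_primitive.
under eq_fun do rewrite (alternating_binomial_sumS (fun l => ln (_ + l%:R * lam))).
have term0 (l : nat) : ln (x + l%:R * lam) - ln (x + l.+1%:R * lam) @[x --> +oo] --> 0.
  rewrite -oppr0; under eq_fun do rewrite -opprB.
  apply: cvgN.
  under eq_fun do rewrite mulrSr mulrDl mul1r addrA.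
  apply: (cvg_comp _ _ (cvg_addrr (l%:R * lam)) (cvgr_log_shift lam0)).
have := @cvg_big R _ +%R 0 predT (@add_continuous R) _ +oo (index_enum 'I_k.+1) _ _ _
  (fun (j : 'I_k.+1) _ => cvgMl_tmp (a := 'C(k, j)%:R * (-1) ^+ j) (term0 j)).
rewrite big1 => [|j _]; last by rewrite mulr0.
move=> sum0; have := cvgMl_tmp (a := (k.+1`!%:R * lam ^+ k.+1)^-1) (sum0 _ _).
by rewrite mulr0; exact.
Qed.

End PartialFractions.

(** * Improper integrals over a half-line *)

Section Integrals.
Context {R : realType}.
Implicit Types (a c lam x : R) (k : nat).

Lemma ge0_integral_itvy_primitive (f F : R -> R) a l :
  (forall x, a <= x -> 0 <= f x) ->
  (forall x, a <= x -> {for x, continuous f}) ->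
  (forall x, a <= x -> is_derive x 1 F (f x)) ->
  F x @[x --> +oo] --> l ->
  (\int[lebesgue_measure]_(x in `[a, +oo[) (f x)%:E = (l - F a)%:E)%E.
Proof.
move=> f0 cf dF Fl; rewrite EFinB; apply: ge0_continuous_FTC2y => //.
- apply/continuous_within_itvcyP; split.
    by move=> x /[!in_itv]/= /andP[ax _]; exact/cf/ltW.
  by apply: cvg_at_right_filter; exact: cf.
- by move=> x ax; have [] := dF _ (ltW ax).
- apply: cvg_at_right_filter.
  apply: differentiable_continuous; apply/derivable1_diffP.
  by have [] := dF _ (lexx a).
- move=> x /[!in_itv]/= /andP[ax _]; rewrite derive1E.
  by have [_] := dF _ (ltW ax).
Qed.

Lemma continuous_gen_rising_shift lam c k :
  continuous (fun x => gen_rising lam (x + c) k).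
Proof.
elim: k => [|k IHk] x.
  by under eq_fun do rewrite gen_rising0; exact: cvg_cst.
under eq_fun do rewrite gen_risingS.
by apply: cvgM; [exact: IHk|do 2!(apply: cvgD; last exact: cvg_cst); exact: cvg_id].
Qed.

Lemma continuous_gen_rising_shiftV lam c k x : 0 <= lam -> 0 < x + c ->
  {for x, continuous (fun x => (gen_rising lam (x + c) k)^-1)}.
Proof.
move=> lam0 xc0; apply: cvgV; last exact: continuous_gen_rising_shift.
by rewrite gt_eqF // gen_rising_gt0.
Qed.

Lemma integral_gen_risingV lam c a k : (0 < k)%N -> 0 < lam -> 0 < a + c ->
  (\int[lebesgue_measure]_(x in `[a, +oo[) ((gen_rising lam (x + c) k.+1)^-1)%:E =
   (- log_gen_rising_primitive lam k (a + c))%:E)%E.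
Proof.
move=> k0 lam0 ac0.
have xc0 x : a <= x -> 0 < x + c by move=> ax; rewrite (lt_le_trans ac0) // lerD2r.
rewrite -[in RHS]sub0r.
apply: (ge0_integral_itvy_primitive
  (F := fun x => log_gen_rising_primitive lam k (x + c))) => [x ax|x ax|x ax|].
- by rewrite invr_ge0 ltW // gen_rising_gt0 ?xc0 // ltW.
- by apply: continuous_gen_rising_shiftV; rewrite ?xc0 // ltW.
- rewrite -[X in is_derive _ _ _ X]mulr1.
  apply: (@is_derive1_comp _ (log_gen_rising_primitive lam k) (fun x => x + c)).
    by apply: is_derive_log_primitive; rewrite ?xc0.
  by apply: is_derive_eq; rewrite addr0.
- exact: (cvg_comp _ _ (cvg_addrr c) (cvgr_log_primitive k0 lam0)).
Qed.

Lemma integral_expSV a k : (0 < k)%N -> 0 < a ->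
  (\int[lebesgue_measure]_(x in `[a, +oo[) ((x ^+ k.+1)^-1)%:E =
   ((k%:R * a ^+ k)^-1)%:E)%E.
Proof.
move=> k0 a0.
have x0 x : a <= x -> 0 < x by exact: lt_le_trans.
have kR0 : k%:R != 0 :> R by rewrite pnatr_eq0 -lt0n.
rewrite -[in RHS](opprK (k%:R * a ^+ k)^-1) -[in RHS]sub0r.
apply: (ge0_integral_itvy_primitive
  (F := fun x => - (k%:R * x ^+ k)^-1) (l := 0)) => [x ax|x ax|x ax|].
- by rewrite invr_ge0 exprn_ge0 // ltW // x0.
- apply: cvgV; first by rewrite gt_eqF // exprn_gt0 // x0.
  exact: exprn_continuous.
- have xk0 : k%:R * x ^+ k != 0 by rewrite mulf_neq0 // expf_neq0 // gt_eqF // x0.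
  have dk : is_derive x 1 (fun z : R => k%:R * z ^+ k) (k%:R * (k%:R * x ^+ k.-1)).
    apply: (@is_deriveZ _ _ _ (fun z : R => z ^+ k)); apply: DeriveDef; first exact: exprn_derivable.
    by rewrite exp_derive /GRing.scale /= mulr1.
  have dN : is_derive x 1 (fun z : R => - (k%:R * z ^+ k)^-1) _ :=
    is_deriveN (is_deriveV (f := fun z : R => k%:R * z ^+ k) xk0 dk).
  apply: (is_derive_eq dN).
  rewrite /GRing.scale /=; case: k k0 kR0 xk0 {dk dN} => // k _ kR0 _.
  have xn0 : x != 0 by rewrite gt_eqF // x0.
  by rewrite !exprS; field; rewrite nat1r kR0 xn0 expf_neq0.
- rewrite -oppr0; apply: cvgN; apply/gtr0_cvgV0.
    by apply: filterS (nbhs_pinfty_gt (num_real (0 : R))) => x xgt0; rewrite mulr_gt0 ?ltr0n ?exprn_gt0.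
  (* For [x >= 1] the denominator dominates [x], since [x <= x ^+ k <= k x ^+ k]. *)
  apply: ger_cvgy (@cvg_id _ _).
  apply: filterS (nbhs_pinfty_ge (num_real (1 : R))) => x x1.
  have : x ^+ 1 <= x ^+ k by exact: ler_weXn2l.
  have : x ^+ k <= k%:R * x ^+ k.
    by rewrite ler_peMl ?exprn_ge0 ?(le_trans ler01) // ler1n.
  by rewrite expr1; lra.
Qed.

End Integrals.

Theorem theorem11 (R : realType) (r k : nat) (lam a : R)
    (hk : (0 < k)%N) (hlam : 0 < lam) (ha : 0 < a) :
  (\int[lebesgue_measure]_(x in `[a, +oo[)
      ((\prod_(j < k.+1) (x + r%:R + j%:R * lam))^-1)%:E =
    ((k`!%:R * lam ^+ k)^-1 *
      \sum_(l < k.+1) 'C(k, l)%:R * (-1) ^+ l.+1 * ln (a + r%:R + l%:R * lam))%:E)%E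
  /\
  (\sum_(k <= n < N)
      rstirling1 r lam n k * (n`!%:R * lam ^+ n)^-1 *
      (\sum_(l < n.+1) 'C(n, l)%:R * (-1) ^+ l.+1 * ln (a + r%:R + l%:R * lam)))
    @[N --> \oo] --> (k%:R * a ^+ k)^-1.
Proof.
(* The exponent [l.+1] carries the minus sign of [0 - F (a + r)], the value of the integral for a
   primitive [F] vanishing at infinity. *)
have log_sumE n : (n`!%:R * lam ^+ n)^-1 *
    \sum_(l < n.+1) 'C(n, l)%:R * (-1) ^+ l.+1 * ln (a + r%:R + l%:R * lam) =
    - log_gen_rising_primitive lam n (a + r%:R).
  rewrite /log_gen_rising_primitive -mulrN -sumrN; congr (_ * _).
  by apply: eq_bigr => l _; rewrite exprS mulN1r mulrN mulNr.
have ar0 : 0 < a + r%:R by rewrite ltr_wpDr.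
split; first by rewrite log_sumE integral_gen_risingV.
have lam0 := ltW hlam.
have xr0 x : a <= x -> 0 < x + r%:R.
  by move=> ax; rewrite ltr_wpDr // (lt_le_trans ha).
have GV0 n x : a <= x -> 0 <= (gen_rising lam (x + r%:R) n.+1)^-1.
  by move=> ax; rewrite invr_ge0 ltW // gen_rising_gt0 // xr0.
pose f n (x : R) := rstirling1 r lam n k / gen_rising lam (x + r%:R) n.+1.
have f0 n x : a <= x -> 0 <= f n x.
  by move=> ax; rewrite mulr_ge0 ?rstirling1_ge0 ?GV0.
have fk0 n x : (n < k)%N -> f n x = 0 by move=> nk; rewrite /f rstirling1_small ?mul0r.
have memP x : `[a, +oo[%classic x -> a <= x by rewrite /= in_itv /= andbT.
have mV n : measurable_fun `[a, +oo[ (fun x => (gen_rising lam (x + r%:R) n.+1)^-1).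
  apply: subspace_continuous_measurable_fun => //.
  apply: continuous_in_subspaceT => x /set_mem /memP ax.
  by apply: continuous_gen_rising_shiftV; rewrite ?xr0.
have mf n : measurable_fun `[a, +oo[ (f n) by apply: measurable_funM.
have intf n : (\int[lebesgue_measure]_(x in `[a, +oo[) (f n x)%:E =
    (rstirling1 r lam n k * - log_gen_rising_primitive lam n (a + r%:R))%:E)%E.
  (* The case [n < k] contains [n = 0], where [1 / (x + r)] has infinite integral; there the bracket
     is [0], so the integrand vanishes identically. *)
  have [nk|kn] := ltnP n k.
    rewrite rstirling1_small // mul0r; apply: integral0_eq => x _.
    by rewrite fk0.
  rewrite EFinM -integral_gen_risingV //; last exact: leq_trans kn.
  under eq_integral do rewrite EFinM.
  rewrite ge0_integralZl_EFin ?rstirling1_ge0 //.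
    by move=> x /memP ax; rewrite lee_fin; exact: GV0.
  by apply/measurable_EFinP; exact: mV.
have partial_sum N : (\int[lebesgue_measure]_(x in `[a, +oo[) (\sum_(n < N) f n x)%:E =
    (\sum_(n < N) rstirling1 r lam n k *
      - log_gen_rising_primitive lam n (a + r%:R))%:E)%E.
  under eq_integral do rewrite -sumEFin.
  rewrite ge0_integral_sum //.
  - by under eq_bigr do rewrite intf; rewrite sumEFin.
  - by move=> n; apply/measurable_EFinP; exact: mf.
  - by move=> n x /memP ax; rewrite lee_fin f0.
have nat_sum N : \sum_(k <= n < N) rstirling1 r lam n k * (n`!%:R * lam ^+ n)^-1 *
      (\sum_(l < n.+1) 'C(n, l)%:R * (-1) ^+ l.+1 * ln (a + r%:R + l%:R * lam)) =
    \sum_(n < N) rstirling1 r lam n k * - log_gen_rising_primitive lam n (a + r%:R).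
  (* The sum may start at [0], because the brackets with [n < k] vanish. *)
  rewrite (big_nat_widenl _ 0) // big_mkcond big_mkord; apply: eq_bigr => n _.
  case: leqP => nk; first by rewrite -mulrA log_sumE.
  by rewrite rstirling1_small // !mul0r.
under eq_fun do rewrite nat_sum.
have : (\int[lebesgue_measure]_(x in `[a, +oo[) (\sum_(n < N) f n x)%:E @[N --> \oo] -->
    \int[lebesgue_measure]_(x in `[a, +oo[) limn (fun N => (\sum_(n < N) f n x)%:E))%E.
  apply: cvg_monotone_convergence => //.
  - by move=> N; apply/measurable_EFinP; apply: measurable_sum => n; exact: mf.
  - by move=> N x /memP ax; rewrite lee_fin sumr_ge0 // => n _; exact: f0.
  - move=> x /memP ax; apply/nondecreasing_seqP => N.
    by rewrite lee_fin big_ord_recr /= lerDl f0.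
under eq_fun do rewrite partial_sum.
(* The limit integral is finite, so convergence in the extended reals gives convergence in [R]; its
   integrand is the pointwise sum [(x ^+ k.+1)^-1]. *)
rewrite (_ : (\int[_]_(x in _) _)%E = (k%:R * a ^+ k)^-1%:E); first exact: fine_cvg.
rewrite -integral_expSV //; apply: eq_integral => x /set_mem /memP ax.
apply/cvg_lim => //; apply: cvg_EFin; first exact: nearW.
by apply: cvgr_rstirling1_series => //; exact: lt_le_trans ax.
Qed.
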